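(* For every $\varepsilon>0$ there exist $\delta>0$ and $n_0$ such that the following holds for all $n\ge n_0$. If $G$ is a graph on $n$ vertices that contains no cycle of length $4$ (i.e. $G$ is $C_4$-free) and contains at most $\delta n^{5/2}$ copies of the $5$-cycle $C_5$, then $G$ can be made $C_5$-free by removing at most $\varepsilon n^{3/2}$ edges.
   Context: A copy of $C_k$ in a graph $G$ means a subgraph of $G$ isomorphic to the cycle $C_k$ on $k$ vertices. Equivalently, the statement says: an $n$-vertex $C_4$-free graph with $o(n^{5/2})$ copies of $C_5$ can be made $C_5$-free by removing $o(n^{3/2})$ edges. *)

(* Defs.v *)
From HB Require Import structures.
From mathcomp Require Import all_boot all_order all_algebra.
From mathcomp Require Import reals.
Set Implicit Arguments. Unset Strict Implicit. Unset Printing Implicit Defensive.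
Import Order.TTheory GRing.Theory Num.Theory.

Definition simple_graph (T : finType) (G : {set {set T}}) : Prop :=
  forall e, e \in G -> #|e| = 2.

Definition is_cycle_copy (T : finType) (k : nat) (F : {set {set T}}) : bool :=
  [exists f : {ffun 'I_k -> T},
     injectiveb f && (F == [set [set f i; f (ordS i)] | i : 'I_k])].

(* Number of copies of C_k in G (a copy of a cycle, i.e. a subgraph
   isomorphic to C_k, is determined by its edge set). *)
Definition num_cycle_copies (T : finType) (k : nat) (G : {set {set T}}) : nat :=
  #|[set F : {set {set T}} | (F \subset G) && is_cycle_copy k F]|.

Definition Ck_free (T : finType) (k : nat) (G : {set {set T}}) : Prop :=
  num_cycle_copies k G = 0%N.

(* Main.v *)
(** Scale the adjacency function to f = sqrt(n) 1_G, after deleting the edges at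
    vertices of degree above C sqrt(n), which are few because G is C4-free. The
    block averages of f over a vertex partition with boundedly many parts have
    bounded L2 norm, as codegrees are at most 1; hence the energy increment
    argument yields a coarse partition P and a refinement Q such that f is close
    to its Q-average f_Q in cut norm (with an error depending on the size of P)
    and f_Q is close to f_P in L2.

    In a sum over closed 5-walks, the edges can be replaced one at a time by any
    g <= f_Q with values in [0, 1]: after fixing one suitable vertex (or summing
    it out), the remaining factors split into a function of each endpoint of the
    edge being replaced, bounded thanks to the bounds on degrees and codegrees.
    Take g = kappa on the set where f_Q >= kappa, and 0 elsewhere. Deleting the
    edges of G in blocks of P that are light, tiny, or on which f_Q is often below
    kappa costs few edges, and a surviving C5 forces the g-weight of closed
    5-walks, hence the number of C5 in G, to be large. *)

Require Import Defs.
From HB Require Import structures.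
From mathcomp Require Import all_boot all_order all_algebra.
From mathcomp Require Import reals.
From mathcomp Require Import ring lra zify.
Set Implicit Arguments. Unset Strict Implicit. Unset Printing Implicit Defensive.
Import Order.TTheory GRing.Theory Num.Theory.
Local Open Scope ring_scope.

(** * Averages over the classes of a colouring *)

Section Average.
Variables (R : realFieldType) (T : finType).
Implicit Types (f h : T -> R).

Definition class_size (C : eqType) (c : T -> C) (t : T) : R :=
  \sum_(u | c u == c t) 1.

(** The conditional expectation of [f] given the colour. The class of [t] contains [t], so the
    denominator is positive. *)
Definition avg (C : eqType) (c : T -> C) f (t : T) : R :=
  (\sum_(u | c u == c t) f u) / class_size c t.

Lemma class_size_gt0 (C : eqType) (c : T -> C) t : 0 < class_size c t.
Proof. by rewrite /class_size (bigD1 t) //= ltr_pwDl // sumr_ge0. Qed.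

Lemma eq_class_size (C : eqType) (c : T -> C) t u :
  c t = c u -> class_size c t = class_size c u.
Proof. by rewrite /class_size => ->. Qed.

Lemma eq_avg (C : eqType) (c : T -> C) f t u :
  c t = c u -> avg c f t = avg c f u.
Proof. by rewrite /avg /class_size => ->. Qed.

Lemma avg_ge0 (C : eqType) (c : T -> C) f t :
  (forall u, 0 <= f u) -> 0 <= avg c f t.
Proof.
by move=> f0; rewrite divr_ge0 ?sumr_ge0 // ltW ?class_size_gt0.
Qed.

Lemma avgM_class_size (C : eqType) (c : T -> C) f t :
  avg c f t * class_size c t = \sum_(u | c u == c t) f u.
Proof. by rewrite divfK // gt_eqF // class_size_gt0. Qed.

(** Averaging is self-adjoint and fixes functions that are constant on classes: after exchanging the
    sums, [f u] meets [h u] once for each member of its class, divided by the class size. *)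
Lemma sum_avgM (C : eqType) (c : T -> C) f h :
  (forall t u, c t = c u -> h t = h u) ->
  \sum_t avg c f t * h t = \sum_t f t * h t.
Proof.
move=> hc.
under eq_bigr => t _ do rewrite /avg -mulrA mulr_suml.
rewrite (exchange_big_dep predT) //=; apply: eq_bigr => u _.
rewrite -mulr_sumr; congr (_ * _).
under eq_bigr => t /eqP ct do rewrite -(hc _ _ ct) -(eq_class_size ct).
rewrite -[RHS](mulVKf (lt0r_neq0 (class_size_gt0 c u))) mulrCA.
rewrite -mulr_suml.
under eq_bigr => t _ do rewrite -[_^-1]mul1r.
rewrite -mulr_suml -mulrA mulrC -mulrA; congr (_ * _).
rewrite mulrC; congr (_ * _).
by apply: eq_bigl => t; rewrite eq_sym.
Qed.

(** Pythagoras: [avg c f] is the orthogonal projection of [avg d f] onto the functions constant on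
    the coarser classes. *)
Lemma sum_sqr_avgB (C D : eqType) (c : T -> C) (d : T -> D) f :
  (forall t u, d t = d u -> c t = c u) ->
  \sum_t (avg d f t - avg c f t) ^+ 2 =
    \sum_t avg d f t ^+ 2 - \sum_t avg c f t ^+ 2.
Proof.
move=> dc.
have E1 : \sum_t avg d f t * avg c f t = \sum_t avg c f t ^+ 2.
  rewrite sum_avgM; last by move=> t u /dc; apply: eq_avg.
  by rewrite -(@sum_avgM _ c) // => t u; apply: eq_avg.
under eq_bigr => t _ do rewrite sqrrB.
rewrite big_split sumrB /= sumrMnl E1; ring.
Qed.

Lemma le_sum_sqr_avg (C D : eqType) (c : T -> C) (d : T -> D) f :
  (forall t u, d t = d u -> c t = c u) ->
  \sum_t avg c f t ^+ 2 <= \sum_t avg d f t ^+ 2.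
Proof.
move=> dc; rewrite -subr_ge0 -sum_sqr_avgB //.
by apply: sumr_ge0 => t _; apply: sqr_ge0.
Qed.

End Average.

Lemma sum_pair (R : realFieldType) (V W : finType) (F : V * W -> R) :
  \sum_p F p = \sum_x \sum_y F (x, y).
Proof. by rewrite pair_big /=; apply: eq_bigr => -[]. Qed.

(** * Block averages on pairs of vertices and their energy *)

Section Energy.
Variables (R : realFieldType) (V : finType).
Implicit Types (P Q : V -> nat) (f : V * V -> R).

Definition pair_color P (p : V * V) : nat * nat := (P p.1, P p.2).

Definition block_avg P f : V * V -> R := avg (pair_color P) f.

Definition refines Q P := forall x y, Q x = Q y -> P x = P y.

(** Colours are natural numbers, so this bounds the number of parts by [k]. *)
Definition bounded_by k P := forall x, (P x < k)%N.

Definition energy P f := \sum_p block_avg P f p ^+ 2.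

Lemma refines_pair_color P Q : refines Q P ->
  forall p q, pair_color Q p = pair_color Q q -> pair_color P p = pair_color P q.
Proof. by move=> QP p q [/QP e1 /QP e2]; rewrite /pair_color e1 e2. Qed.

Lemma energy_ge0 P f : 0 <= energy P f.
Proof. by apply: sumr_ge0 => p _; apply: sqr_ge0. Qed.

Lemma class_size_pair P p :
  class_size R (pair_color P) p = class_size R P p.1 * class_size R P p.2.
Proof.
rewrite /class_size big_distrlr /= pair_big /=.
under [RHS]eq_bigr do rewrite mulr1.
by apply: eq_bigl => q; rewrite /pair_color xpair_eqE.
Qed.

(** Each nonempty class contributes exactly 1. *)
Lemma sum_inv_class_size k P : bounded_by k P ->
  \sum_x (class_size R P x)^-1 <= k%:R.
Proof.
move=> Pk.
rewrite (partition_big (fun x => Ordinal (Pk x)) predT) //=.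
rewrite -[k in k%:R]card_ord -sum1_card natr_sum; apply: ler_sum => i _.
have [|n0] := boolP [exists x, P x == i]; last first.
  rewrite big_pred0 // => x; apply/negP => /eqP xi.
  by case/existsP: n0; exists x; rewrite -xi.
case/existsP => x0 /eqP x0i.
rewrite (eq_bigl (fun x => P x == P x0)); last first.
  by move=> x; rewrite x0i -val_eqE.
under eq_bigr => x /eqP xx do rewrite (eq_class_size _ xx) -[_^-1]mul1r.
by rewrite -mulr_suml divff // gt_eqF // class_size_gt0.
Qed.

(* Averaging in the first variable only increases the L2 norm, and turns the
   energy into an average of codegrees. *)
Lemma energy_le (E : V -> V -> R) (s Delta : R) k P :
  bounded_by k P ->
  s ^+ 2 = #|V|%:R ->
  (forall x y, 0 <= E x y) -> (forall x y, E x y ^+ 2 <= E x y) ->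
  (forall x, \sum_y E x y <= Delta) ->
  (forall x x', x != x' -> \sum_y E x y * E x' y <= 1) ->
  energy P (fun p => s * E p.1 p.2) <= #|V|%:R ^+ 2 + k%:R * #|V|%:R * Delta.
Proof.
move=> Pk s2 E0 E1 deg codeg.
set f := fun p => _; pose c (p : V * V) := (P p.1, p.2).
have n0 : 0 <= #|V|%:R :> R by apply: ler0n.
apply: (@le_trans _ _ (\sum_p avg c f p ^+ 2)).
  apply: le_sum_sqr_avg => p q []; rewrite /pair_color => -> ->; done.
have -> : \sum_p avg c f p ^+ 2 = \sum_p f p * avg c f p.
  by rewrite -(@sum_avgM _ _ _ c) // => t u; apply: eq_avg.
have cs p : class_size R c p = class_size R P p.1.
  rewrite /class_size.
  rewrite [RHS](eq_bigr (fun x => \sum_(y | y == p.2) 1)); last first.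
    by move=> x _; rewrite big_pred1_eq.
  by rewrite pair_big /=; apply: eq_bigl => q; rewrite /c xpair_eqE.
have avE x y : avg c f (x, y) =
    s * (\sum_(x' | P x' == P x) E x' y) / class_size R P x.
  rewrite /avg cs mulr_sumr; congr (_ / _).
  rewrite [RHS](eq_bigr (fun x' => \sum_(y' | y' == y) s * E x' y')); last first.
    by move=> x' _; rewrite big_pred1_eq.
  by rewrite pair_big /=; apply: eq_bigl => q; rewrite /c xpair_eqE.
rewrite -(pair_bigA _ (fun x y => f (x, y) * avg c f (x, y))) /=.
(* The sign of [Delta] is known only once there is a vertex; the empty vertex set is settled at the
   end. *)
have D0 (x : V) : 0 <= Delta by apply: le_trans _ (deg x); apply: sumr_ge0.
have rowb x : \sum_y f (x, y) * avg c f (x, y) <=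
    #|V|%:R * (1 + Delta * (class_size R P x)^-1).
  have -> : \sum_y f (x, y) * avg c f (x, y) =
      #|V|%:R / class_size R P x *
        \sum_(x' | P x' == P x) \sum_y E x y * E x' y.
    rewrite exchange_big /= mulr_sumr; apply: eq_bigr => y _.
    rewrite avE /f /= -mulr_sumr -s2; ring.
  rewrite -mulrA ler_wpM2l // mulrC ler_pdivrMr ?class_size_gt0 //.
  rewrite mulrDl mul1r mulfVK ?gt_eqF ?class_size_gt0 //.
  (* The term [x' = x] is at most a degree; every other term is a codegree. *)
  apply: (@le_trans _ _ (\sum_(x' | P x' == P x) (1 + (x' == x)%:R * Delta))).
    apply: ler_sum => x' _; case: eqVneq => [->|ne].
      rewrite mul1r; apply: (@le_trans _ _ (\sum_y E x y)).
        by apply: ler_sum => y _; rewrite -expr2.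
      by apply: le_trans (deg x) _; rewrite lerDr.
    by rewrite mul0r addr0 codeg // eq_sym.
  rewrite big_split /= lerD2l (bigD1 x) //= eqxx mul1r big1 ?addr0 //.
  by move=> x' /andP[_ /negbTE ->]; rewrite mul0r.
apply: le_trans (ler_sum _ (fun x _ => rowb x)) _.
rewrite -mulr_sumr big_split /= sumr_const -mulr_sumr.
have -> : #|V|%:R ^+ 2 + k%:R * #|V|%:R * Delta =
    #|V|%:R * (#|V|%:R + Delta * k%:R) by ring.
case: (pickP V) => [x _|V0]; last by rewrite (eq_card0 V0) !mul0r.
by rewrite ler_wpM2l // lerD2l ler_wpM2l ?(D0 x) // sum_inv_class_size.
Qed.

End Energy.

(** * Counting closed 5-walks by replacing one edge at a time *)

Section Counting.
Variables (R : realFieldType) (V : finType).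

(* A bilinear form on [0, alpha]^V x [0, beta]^V is maximal at a vertex of the
   box, so set discrepancy controls function discrepancy. *)
Lemma bilinear_cut_le (D : V -> V -> R) (a b : V -> R) (alpha beta c : R) :
  (forall S T : {set V}, \sum_(x in S) \sum_(y in T) D x y <= c) ->
  (forall x, 0 <= a x <= alpha) -> (forall y, 0 <= b y <= beta) ->
  0 <= alpha -> 0 <= beta ->
  \sum_x \sum_y D x y * a x * b y <= alpha * beta * c.
Proof.
move=> cut ab bb al0 be0.
(* A linear form on a box is largest when each coordinate is [m] or 0 according to the sign of its
   coefficient. This is used once for [a] and once for [b]. *)
have half (L : V -> R) (u : V -> R) (m : R) : (forall x, 0 <= u x <= m) ->
    \sum_x L x * u x <= m * \sum_(x in [set x | 0 <= L x]) L x.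
  move=> um; rewrite mulr_sumr [leRHS]big_mkcond /=; apply: ler_sum => x _.
  rewrite inE; have /andP[u0 uM] := um x.
  case: ifP => [L0|/negbT]; first by rewrite mulrC ler_wpM2r.
  by rewrite -ltNge => /ltW L0; rewrite mulr_le0_ge0.
pose L x := \sum_y D x y * b y.
have -> : \sum_x \sum_y D x y * a x * b y = \sum_x L x * a x.
  apply: eq_bigr => x _; rewrite mulr_suml; apply: eq_bigr => y _.
  by rewrite mulrAC.
apply: le_trans (half L a alpha ab) _; rewrite -mulrA ler_wpM2l //.
set S := [set _ | _].
have -> : \sum_(x in S) L x = \sum_y (\sum_(x in S) D x y) * b y.
  rewrite exchange_big /=; apply: eq_bigr => y _; by rewrite mulr_suml.
apply: le_trans (half _ b beta bb) _; rewrite ler_wpM2l //.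
by rewrite exchange_big /= cut.
Qed.

Variables (E g : V -> V -> R) (s Delta eta : R).
Let n : R := #|V|%:R.
Hypothesis E01 : forall x y, 0 <= E x y <= 1.
Hypothesis degE : forall x, \sum_y E x y <= Delta.
Hypothesis codegE : forall x x', x != x' -> \sum_y E x y * E y x' <= 1.
Hypothesis g01 : forall x y, 0 <= g x y <= 1.
Hypothesis Delta0 : 0 <= Delta.
Hypothesis s0 : 0 <= s.
Hypothesis s2 : s ^+ 2 = n.
Hypothesis cutg : forall S T : {set V},
  \sum_(x in S) \sum_(y in T) (g x y - s * E x y) <= eta * n ^+ 2.

Let d x y := \sum_w E x w * E w y.

(** The diagonal, where [d] is only bounded by [Delta], is cut off so that the values lie in
    [0, 1]. *)
Definition codegree x y := (x != y)%:R * d x y.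

(* [x, y, w, z, v] is a closed walk with [y != z] and [z != x], the walks
   [y w z] and [z v x] being counted by codegrees. *)
Definition num_walks5 : R :=
  \sum_z \sum_x \sum_y E x y * codegree z x * codegree y z.

(** One edge factor [g] is exchanged for [s * E]: for each fixed [i] the other factors split over
    the two endpoints, and the cut bound costs one error term per index. *)
Lemma cut_step (I : finType) (a b : I -> V -> R) (alpha beta : R) :
  (forall i x, 0 <= a i x <= alpha) -> (forall i y, 0 <= b i y <= beta) ->
  0 <= alpha -> 0 <= beta ->
  \sum_i \sum_x \sum_y g x y * a i x * b i y <=
    s * (\sum_i \sum_x \sum_y E x y * a i x * b i y)
    + #|I|%:R * (alpha * beta * (eta * n ^+ 2)).
Proof.
move=> ab bb al0 be0.
rewrite mulr_sumr -lerBlDl -sumrB.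
rewrite mulr_natl -sumr_const; apply: ler_sum => i _.
apply: le_trans (bilinear_cut_le cutg (ab i) (bb i) al0 be0).
rewrite mulr_sumr -sumrB; apply: ler_sum => x _.
rewrite mulr_sumr -sumrB; apply: ler_sum => y _.
by rewrite le_eqVlt; apply/orP; left; apply/eqP; ring.
Qed.

Let E0 x y : 0 <= E x y. Proof. by case/andP: (E01 x y). Qed.
Let E1 x y : E x y <= 1. Proof. by case/andP: (E01 x y). Qed.
Let g0 x y : 0 <= g x y. Proof. by case/andP: (g01 x y). Qed.
Let g1 x y : g x y <= 1. Proof. by case/andP: (g01 x y). Qed.

Let d0 x y : 0 <= d x y.
Proof. by apply: sumr_ge0 => w _; apply: mulr_ge0. Qed.

Let ddelta x y : d x y <= Delta.
Proof.
apply: le_trans (degE x); apply: ler_sum => w _.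
by rewrite ler_piMr.
Qed.

Lemma codegree01 x y : 0 <= codegree x y <= 1.
Proof.
rewrite /codegree; case: eqVneq => [_|ne]; first by rewrite mul0r lexx ler01.
by rewrite mul1r d0 codegE.
Qed.
Let c0 x y : 0 <= codegree x y. Proof. by case/andP: (codegree01 x y). Qed.
Let c1 x y : codegree x y <= 1. Proof. by case/andP: (codegree01 x y). Qed.

Let d_le x y : d x y <= codegree x y + (x == y)%:R * Delta.
Proof.
rewrite /codegree; case: eqVneq => [_|ne] /=.
  by rewrite mul0r add0r mul1r.
by rewrite mul1r mul0r addr0.
Qed.

Let n0 : 0 <= n. Proof. exact: ler0n. Qed.

Let sum_le1 (F : V -> R) : (forall x, F x <= 1) -> \sum_x F x <= n.
Proof.
move=> F1; apply: le_trans (ler_sum _ (fun x _ => F1 x)) _.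
by rewrite sumr_const.
Qed.

Let sum_le (F : V -> R) m : (forall x, F x <= m) -> \sum_x F x <= n * m.
Proof.
move=> F1; apply: le_trans (ler_sum _ (fun x _ => F1 x)) _.
by rewrite sumr_const mulr_natl.
Qed.

(** [d] and [codegree] differ only on the diagonal, where each of the [n] vertices costs at most
    [m * Delta]. *)
Let diag (u : V -> V -> R) m :
  (forall x y, 0 <= u x y <= m) ->
  \sum_x \sum_y u x y * d x y <=
    \sum_x \sum_y u x y * codegree x y + n * (m * Delta).
Proof.
move=> um; rewrite -lerBlDl -sumrB; apply: sum_le => x; rewrite -sumrB.
apply: (@le_trans _ _ (\sum_y (x == y)%:R * (u x y * Delta))).
  apply: ler_sum => y _; rewrite lerBlDl.
  have /andP[u0 _] := um x y.
  apply: le_trans (ler_wpM2l u0 (d_le x y)) _.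
  by rewrite mulrDr [u x y * (_ * Delta)]mulrCA.
rewrite (bigD1 x) //= eqxx mul1r big1 ?addr0.
  by rewrite ler_wpM2r //; case/andP: (um x x).
by move=> y; rewrite eq_sym => /negbTE ->; rewrite mul0r.
Qed.


(** The sums [X1] to [X5] carry one to five factors [g], the other edges being counted by [E].
    [cut_step] leads from each to the next; [Y1] and [Y3] are the intermediate sums in which
    [codegree] has been restored to the full [d], so that its two edges can be handled
    separately. *)
Lemma counting :
  \sum_x \sum_y \sum_w \sum_z \sum_v g x y * g y w * g w z * g z v * g v x <=
    s ^+ 5 * num_walks5
    + eta * (n ^+ 5 + s * Delta * n ^+ 4 + n ^+ 5 + Delta * s * n ^+ 4 + n ^+ 5)
    + 2 * Delta * n ^+ 4.
Proof.
pose codeg := codegree.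
have nneg : 0 <= n := n0.
have g00 a b x y : 0 <= g a b * g x y by rewrite mulr_ge0.
have g11 a b x y : g a b * g x y <= 1.
  by apply: le_trans (g1 x y); rewrite ler_piMl.
have gg x y : 0 <= \sum_w g x w * g w y <= n.
  by rewrite sumr_ge0 // sum_le1.
pose X1 := \sum_z \sum_x \sum_y g x y * codeg z x * codeg y z.
have S1 : X1 <= s * num_walks5 + n * (1 * 1 * (eta * n ^+ 2)).
  by apply: (@cut_step V (fun z x => codeg z x) (fun z y => codeg y z)) => // *;
    apply: codegree01.
pose u y z := \sum_x g x y * codeg z x.
pose Y1 := \sum_y \sum_z u y z * d y z.
have D1 : Y1 <= X1 + n * (n * Delta).
  have -> : X1 = \sum_y \sum_z u y z * codeg y z.
    rewrite [RHS]exchange_big; apply: eq_bigr => z _ /=.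
    rewrite exchange_big; apply: eq_bigr => y _ /=.
    by rewrite mulr_suml.
  apply: diag => x y; rewrite /u sumr_ge0 => [|i _]; last by rewrite mulr_ge0 ?c0.
  by rewrite sum_le1 // => i; apply: le_trans (c1 y i); rewrite ler_piMl ?c0.
(* With [x] fixed, summing out [z] leaves a function of [w] bounded by a degree, whence the factor
   [Delta] in the error. *)
pose X2 := \sum_x \sum_y \sum_w g y w * g x y * \sum_z E w z * codeg z x.
have S2 : X2 <= s * Y1 + n * (1 * Delta * (eta * n ^+ 2)).
  have -> : Y1 = \sum_x \sum_y \sum_w E y w * g x y * \sum_z E w z * codeg z x.
    rewrite [RHS]exchange_big; apply: eq_bigr => y _ /=.
    under eq_bigr => z _ do rewrite /u /d big_distrlr /=.
    rewrite exchange_big; apply: eq_bigr => x _ /=.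
    rewrite exchange_big; apply: eq_bigr => w _ /=.
    by rewrite mulr_sumr; apply: eq_bigr => z _; ring.
  apply: (@cut_step V (fun x y => g x y) (fun x w => \sum_z E w z * codeg z x)) => // x w.
  rewrite sumr_ge0 => [|i _]; last by rewrite mulr_ge0 ?c0.
  apply: le_trans (degE w); apply: ler_sum => z _.
  by rewrite ler_piMr ?c1.
pose X3 := \sum_x \sum_w \sum_z g w z * (\sum_y g x y * g y w) * codeg z x.
have S3 : X3 <= s * X2 + n * (n * 1 * (eta * n ^+ 2)).
  have -> : X2 = \sum_x \sum_w \sum_z E w z * (\sum_y g x y * g y w) * codeg z x.
    apply: eq_bigr => x _; rewrite exchange_big; apply: eq_bigr => w _ /=.
    transitivity ((\sum_y g x y * g y w) * (\sum_z E w z * codeg z x)).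
      by rewrite mulr_suml; apply: eq_bigr => y _; ring.
    by rewrite mulr_sumr; apply: eq_bigr => z _; ring.
  by apply: (@cut_step V (fun x w => \sum_y g x y * g y w) (fun x z => codeg z x))
    => // *; apply: codegree01.
pose t z x := \sum_y g x y * (\sum_w g y w * g w z).
pose Y3 := \sum_z \sum_x t z x * d z x.
have D3 : Y3 <= X3 + n * (n * n * Delta).
  have -> : X3 = \sum_z \sum_x t z x * codeg z x.
    rewrite [RHS]exchange_big; apply: eq_bigr => x _ /=.
    rewrite exchange_big; apply: eq_bigr => z _ /=.
    rewrite -mulr_suml; congr (_ * _); rewrite /t.
    under eq_bigr => w _ do rewrite mulr_sumr.
    rewrite exchange_big; apply: eq_bigr => y _ /=.
    by rewrite mulr_sumr; apply: eq_bigr => w _; ring.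
  apply: diag => z x; rewrite /t sumr_ge0 => [|i _]; last first.
    by rewrite mulr_ge0 //; case/andP: (gg i z).
  apply: sum_le => y; have /andP[h0 h1] := gg y z.
  by apply: le_trans h1; rewrite ler_piMl.
pose X4 := \sum_y \sum_z \sum_v
  g z v * (\sum_w g y w * g w z) * (\sum_x g x y * E v x).
have S4 : X4 <= s * Y3 + n * (n * Delta * (eta * n ^+ 2)).
  have -> : Y3 = \sum_y \sum_z \sum_v
      E z v * (\sum_w g y w * g w z) * (\sum_x g x y * E v x).
    rewrite [RHS]exchange_big; apply: eq_bigr => z _ /=.
    under eq_bigr => x _ do rewrite /t /d big_distrlr /=.
    rewrite exchange_big; apply: eq_bigr => y _ /=.
    rewrite exchange_big; apply: eq_bigr => v _ /=.
    by rewrite mulr_sumr; apply: eq_bigr => x _; ring.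
  apply: (@cut_step V (fun y z => \sum_w g y w * g w z)
                      (fun y v => \sum_x g x y * E v x)) => // y v.
  rewrite sumr_ge0 => [|i _]; last by rewrite mulr_ge0.
  apply: le_trans (degE v); apply: ler_sum => x _.
  by rewrite ler_piMl.
pose a y v := \sum_z g z v * \sum_w g y w * g w z.
pose X5 := \sum_y \sum_v \sum_x g v x * a y v * g x y.
have S5 : X5 <= s * X4 + n * (n * n * 1 * (eta * n ^+ 2)).
  have -> : X4 = \sum_y \sum_v \sum_x E v x * a y v * g x y.
    apply: eq_bigr => y _; rewrite exchange_big; apply: eq_bigr => v _ /=.
    rewrite -mulr_suml -/(a y v) mulr_sumr.
    by apply: eq_bigr => x _; ring.
  apply: (@cut_step V a (fun y x => g x y)) => // [y v|]; last exact: mulr_ge0.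
  rewrite /a sumr_ge0 => [|z _]; last by rewrite mulr_ge0 //; case/andP: (gg y z).
  apply: sum_le => z; have /andP[h0 h1] := gg y z.
  by apply: le_trans h1; rewrite ler_piMl.
have -> : \sum_x \sum_y \sum_w \sum_z \sum_v
    g x y * g y w * g w z * g z v * g v x = X5.
  rewrite exchange_big; apply: eq_bigr => y _ /=.
  rewrite [RHS]exchange_big; apply: eq_bigr => x _ /=.
  under [RHS]eq_bigr => v _ do rewrite /a mulr_sumr mulr_suml.
  rewrite [RHS]exchange_big [LHS]exchange_big; apply: eq_bigr => z _ /=.
  rewrite [LHS]exchange_big; apply: eq_bigr => v _ /=.
  rewrite !mulr_sumr mulr_suml; apply: eq_bigr => w _. ring.
(* Multiplied by suitable powers of [s], the seven inequalities telescope; the slack of the goal is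
   the sum of their slacks. *)
have S1' : s ^+ 4 * X1 <= s ^+ 4 * (s * num_walks5 + n * (1 * 1 * (eta * n ^+ 2))).
  by rewrite ler_wpM2l ?exprn_ge0.
have D1' : s ^+ 4 * Y1 <= s ^+ 4 * (X1 + n * (n * Delta)).
  by rewrite ler_wpM2l ?exprn_ge0.
have S2' : s ^+ 3 * X2 <= s ^+ 3 * (s * Y1 + n * (1 * Delta * (eta * n ^+ 2))).
  by rewrite ler_wpM2l ?exprn_ge0.
have S3' : s ^+ 2 * X3 <= s ^+ 2 * (s * X2 + n * (n * 1 * (eta * n ^+ 2))).
  by rewrite ler_wpM2l ?exprn_ge0.
have D3' : s ^+ 2 * Y3 <= s ^+ 2 * (X3 + n * (n * n * Delta)).
  by rewrite ler_wpM2l ?exprn_ge0.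
have S4' : s * X4 <= s * (s * Y3 + n * (n * Delta * (eta * n ^+ 2))).
  by rewrite ler_wpM2l.
rewrite -subr_ge0.
have -> : s ^+ 5 * num_walks5 + eta * (n ^+ 5 + s * Delta * n ^+ 4 + n ^+ 5 +
    Delta * s * n ^+ 4 + n ^+ 5) + 2 * Delta * n ^+ 4 - X5 =
  (s ^+ 4 * (s * num_walks5 + n * (1 * 1 * (eta * n ^+ 2))) - s ^+ 4 * X1) +
  (s ^+ 4 * (X1 + n * (n * Delta)) - s ^+ 4 * Y1) +
  (s ^+ 3 * (s * Y1 + n * (1 * Delta * (eta * n ^+ 2))) - s ^+ 3 * X2) +
  (s ^+ 2 * (s * X2 + n * (n * 1 * (eta * n ^+ 2))) - s ^+ 2 * X3) +
  (s ^+ 2 * (X3 + n * (n * n * Delta)) - s ^+ 2 * Y3) +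
  (s * (s * Y3 + n * (n * Delta * (eta * n ^+ 2))) - s * X4) +
  (s * X4 + n * (n * n * 1 * (eta * n ^+ 2)) - X5).
  rewrite -s2; ring.
have h x y : x <= y :> R -> 0 <= y - x by rewrite subr_ge0.
by repeat first [exact: h | apply: addr_ge0].
Qed.

End Counting.

(** * Weak and strong regularity by energy increment *)

Section Regularity.
Variables (R : realFieldType) (V : finType) (f : V * V -> R).
Implicit Types (P Q : V -> nat).
Let n : R := #|V|%:R.

(** One-sided: only the excess of the block average over [f] is bounded, which suffices to bound
    weighted walks above by walks in the graph. *)
Definition cut_le Q (c : R) := forall S T : {set V},
  \sum_(x in S) \sum_(y in T) (block_avg Q f (x, y) - f (x, y)) <= c.

Lemma cut_leP Q c : cut_le Q c \/
  exists S T : {set V},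
    c < \sum_(x in S) \sum_(y in T) (block_avg Q f (x, y) - f (x, y)).
Proof.
pose F (p : {set V} * {set V}) :=
  \sum_(x in p.1) \sum_(y in p.2) (block_avg Q f (x, y) - f (x, y)).
have [/existsP[p ltp]|/existsPn nex] := boolP [exists p, c < F p].
  by right; exists p.1, p.2.
by left=> S T; have := nex (S, T); rewrite -leNgt.
Qed.

Lemma refines_trans P Q Q' : refines Q' Q -> refines Q P -> refines Q' P.
Proof. by move=> h1 h2 x y /h1/h2. Qed.

Lemma energyB P Q : refines Q P ->
  \sum_p (block_avg Q f p - block_avg P f p) ^+ 2 = energy Q f - energy P f.
Proof. by move=> QP; apply/sum_sqr_avgB/refines_pair_color. Qed.

(** If [S] and [T] witness a large discrepancy, every part is split along both. The indicator [u] of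
    [S] times [T] is then constant on the new blocks, so the discrepancy is the inner product of [u]
    with the change of block averages, which must be large in L2. *)
Lemma energy_increment k Q (eta : R) : 0 < eta -> bounded_by k Q ->
  ~ cut_le Q (eta * n ^+ 2) ->
  exists Q', [/\ bounded_by (4 * k) Q', refines Q' Q &
    energy Q f + eta ^+ 2 * n ^+ 2 <= energy Q' f].
Proof.
move=> eta0 Qk; have [//|[S [T ltD]] _] := cut_leP Q (eta * n ^+ 2).
(* The two membership bits are stored as the last base-4 digit of the colour. *)
pose Q' x := (4 * Q x + (2 * (x \in S) + (x \in T)))%N.
have Q'E x y : Q' x = Q' y -> [/\ Q x = Q y, (x \in S) = (y \in S)
    & (x \in T) = (y \in T)].
  rewrite /Q'; case: (x \in S); case: (x \in T); case: (y \in S);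
    case: (y \in T) => /= h; split=> //; lia.
have Q'Q : refines Q' Q by move=> x y /Q'E[].
exists Q'; split=> //.
  move=> x; rewrite /Q'; have := Qk x.
  by case: (x \in S); case: (x \in T) => /=; lia.
rewrite -lerBrDl -energyB //.
pose u (p : V * V) : R := (p.1 \in S)%:R * (p.2 \in T)%:R.
have u2 p : u p ^+ 2 = u p.
  by rewrite /u; case: (_ \in S); case: (_ \in T);
    rewrite /= !(mul0r, mul1r, expr0n, expr1n).
have DE : \sum_(x in S) \sum_(y in T) (block_avg Q f (x, y) - f (x, y)) =
    \sum_p (block_avg Q f p - block_avg Q' f p) * u p.
  under [RHS]eq_bigr do rewrite mulrBl.
  rewrite sumrB [X in _ - X]sum_avgM; last first.
    by move=> [x y] [x' y'] [/Q'E[_ h _] /Q'E[_ _ h']]; rewrite /u /= h h'.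
  rewrite -sumrB sum_pair big_mkcond /=; apply: eq_bigr => x _.
  rewrite /u /=; case: (x \in S); last first.
    by rewrite big1 // => y _; rewrite mul0r !mulr0 subrr.
  rewrite big_mkcond /=; apply: eq_bigr => y _.
  by case: (y \in T); rewrite /= mul1r ?mulr1 ?mulr0 ?subrr.
(* 2 eta a u <= a^2 + eta^2 u^2, summed over all pairs *)
have : \sum_p (2 * eta * ((block_avg Q f p - block_avg Q' f p) * u p)) <=
    \sum_p ((block_avg Q' f p - block_avg Q f p) ^+ 2 + eta ^+ 2 * u p).
  apply: ler_sum => p _; rewrite -[u p in X in _ <= X]u2.
  have := sqr_ge0 (block_avg Q f p - block_avg Q' f p - eta * u p); lra.
rewrite -mulr_sumr -DE big_split /= -mulr_sumr.
have : \sum_p u p <= n ^+ 2.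
  apply: (@le_trans _ _ (\sum_(p : V * V) 1)).
    apply: ler_sum => p _; rewrite /u.
    by case: (_ \in S); case: (_ \in T); rewrite /= ?mul0r ?mulr0 ?mulr1.
  by rewrite sumr_const card_prod natrM -expr2.
have := ltW ltD; set D := \sum_(x in S) _; set X := \sum_p _ ^+ 2; set U := \sum_p _.
move=> h1 h2 h3.
have h1' : 2 * eta * (eta * n ^+ 2) <= 2 * eta * D.
  by rewrite ler_wpM2l // mulr_ge0 // ltW.
have h2' : eta ^+ 2 * U <= eta ^+ 2 * n ^+ 2 by rewrite ler_wpM2l ?sqr_ge0.
lra.
Qed.

(** Each failed attempt multiplies the number of parts by at most 4 and raises the energy by
    [eta ^+ 2 * n ^+ 2]; after [m] of them the energy would exceed [B]. *)
Lemma weak_regularity (B eta : R) m k P : 0 < eta -> bounded_by k P ->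
  (forall Q, bounded_by (4 ^ m * k) Q -> energy Q f <= B) ->
  B < energy P f + m%:R * (eta ^+ 2 * n ^+ 2) ->
  exists Q, [/\ bounded_by (4 ^ m * k) Q, refines Q P & cut_le Q (eta * n ^+ 2)].
Proof.
move=> eta0; elim: m k P => [|m IH] k P Pk enB BP.
  by have := enB P; rewrite mul1n => /(_ Pk);
    rewrite leNgt -[energy P f]addr0 -(mul0r (eta ^+ 2 * n ^+ 2)) BP.
have [cutP|[S [T ltD]]] := cut_leP P (eta * n ^+ 2).
  exists P; split=> // x; apply: leq_trans (Pk x) _.
  by rewrite leq_pmull // expn_gt0.
have [|P' [P'k P'P enP']] := energy_increment eta0 Pk.
  by move/(_ S T); rewrite leNgt ltD.
have [||Q [Qk QP' cutQ]] // := IH _ P' P'k.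
- by move=> Q; rewrite mulnA -expnSr; apply: enB.
- apply: lt_le_trans BP _; move: enP'; rewrite -natr1 mulrDl mul1r; lra.
exists Q; split=> //; last exact: refines_trans P'P.
by move: Qk; rewrite mulnA -expnSr.
Qed.

Variables (eta : nat -> R) (m : nat -> nat) (sigma B : R).
Hypothesis eta0 : forall k, 0 < eta k.
Hypothesis mB : forall k, B < (m k)%:R * (eta k ^+ 2 * n ^+ 2).

(** Bound on the number of parts after weak regularity is applied to [k] parts with error
    [eta k]. *)
Definition tower k := (4 ^ m k * k)%N.

Lemma leq_tower j k : (k <= iter j tower k)%N.
Proof.
elim: j => //= j; move/leq_trans; apply.
by rewrite leq_pmull // expn_gt0.
Qed.

(** Weak regularity is iterated: either the refinement is L2-close to the current partition, or by
    Pythagoras the energy grows by more than [sigma * n ^+ 2], which can happen fewer than [j]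
    times. The energy bound is required only up to the final number of parts, because it worsens as
    parts multiply. *)
Lemma strong_regularity j k P : bounded_by k P ->
  (forall k' Q, (k' <= iter j tower k)%N -> bounded_by k' Q -> energy Q f <= B) ->
  B < energy P f + j%:R * (sigma * n ^+ 2) ->
  exists k' P' Q, [/\ (k' <= iter j tower k)%N, bounded_by k' P', refines Q P',
    cut_le Q (eta k' * n ^+ 2) &
    \sum_p (block_avg Q f p - block_avg P' f p) ^+ 2 <= sigma * n ^+ 2].
Proof.
elim: j k P => [|j IH] k P Pk enB BP.
  have := enB k P (leqnn _) Pk.
  by rewrite leNgt -[energy P f]addr0 -(mul0r (sigma * n ^+ 2)) BP.
have [||||Q [Qk QP cutQ]] // := @weak_regularity B (eta k) (m k) k P.
- move=> Q Qk; apply: enB Qk; rewrite iterSr; exact: leq_tower.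
- by apply: lt_le_trans (mB k) _; rewrite lerDr energy_ge0.
have [small|large] := lerP (\sum_p (block_avg Q f p - block_avg P f p) ^+ 2)
  (sigma * n ^+ 2).
  by exists k, P, Q; split=> //; apply: leq_tower.
have [|||k' [P' [Q' [k'le P'k Q'P' cutQ' small]]]] // := IH (tower k) Q.
- by rewrite -iterSr.
- apply: lt_le_trans BP _; move: large; rewrite energyB // -natr1 mulrDl mul1r; lra.
by exists k', P', Q'; split=> //; rewrite iterSr.
Qed.

End Regularity.

(** * Adjacency and copies of C4 and C5 *)

Section Cycles.
Variables (V : finType) (G : {set {set V}}).

Definition adj x y := [set x; y] \in G.

Lemma adjC x y : adj x y = adj y x.
Proof. by rewrite /adj setUC. Qed.

Hypothesis simpleG : simple_graph G.

Lemma adj_neq x y : adj x y -> x != y.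
Proof. by move/simpleG; rewrite cards2; case: eqVneq. Qed.

Lemma is_cycle_copy4 (a b c d : V) : uniq [:: a; b; c; d] ->
  is_cycle_copy 4 [set [set a; b]; [set b; c]; [set c; d]; [set d; a]].
Proof.
move=> U; apply/existsP; exists [ffun i : 'I_4 => nth a [:: a; b; c; d] i].
apply/andP; split.
  apply/injectiveP => i j; rewrite !ffunE => /eqP.
  by rewrite nth_uniq // => /eqP/val_inj.
apply/eqP/setP => e; apply/idP/imsetP.
  rewrite !inE -!orbA => /or4P[] /eqP ->.
  - by exists (inord 0); rewrite // !ffunE /= ?inordK.
  - by exists (inord 1); rewrite // !ffunE /= ?inordK.
  - by exists (inord 2); rewrite // !ffunE /= ?inordK.
  - by exists (inord 3); rewrite // !ffunE /= ?inordK.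
move=> [[i lti] _ ->]; rewrite !ffunE /= !inE.
by case: i lti => [|[|[|[|]]]] //= _; rewrite ?eqxx ?orbT.
Qed.

Lemma is_cycle_copy5 (a b c d e : V) : uniq [:: a; b; c; d; e] ->
  is_cycle_copy 5
    [set [set a; b]; [set b; c]; [set c; d]; [set d; e]; [set e; a]].
Proof.
move=> U; apply/existsP; exists [ffun i : 'I_5 => nth a [:: a; b; c; d; e] i].
apply/andP; split.
  apply/injectiveP => i j; rewrite !ffunE => /eqP.
  by rewrite nth_uniq // => /eqP/val_inj.
apply/eqP/setP => F; apply/idP/imsetP.
  rewrite !inE -!orbA => /orP[|/or4P[]] /eqP ->.
  - by exists (inord 0); rewrite // !ffunE /= ?inordK.
  - by exists (inord 1); rewrite // !ffunE /= ?inordK.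
  - by exists (inord 2); rewrite // !ffunE /= ?inordK.
  - by exists (inord 3); rewrite // !ffunE /= ?inordK.
  - by exists (inord 4); rewrite // !ffunE /= ?inordK.
move=> [[i lti] _ ->]; rewrite !ffunE /= !inE.
by case: i lti => [|[|[|[|[|]]]]] //= _; rewrite ?eqxx ?orbT.
Qed.

(** Two common neighbours [u] and [v] of [x] and [y] would give the 4-cycle [x u y v]. *)
Lemma codegree_le1 : Ck_free 4 G -> forall x y, x != y ->
  (#|[set w | adj x w && adj w y]| <= 1)%N.
Proof.
move=> free x y xy; apply/card_le1_eqP => u v; rewrite !inE.
move=> /andP[xu uy] /andP[xv vy]; apply/eqP; apply/negPn/negP => uv.
have := free; rewrite /num_cycle_copies => /eqP; rewrite cards_eq0.
apply/negP/set0Pn; exists [set [set x; u]; [set u; y]; [set y; v]; [set v; x]].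
rewrite inE is_cycle_copy4; last first.
  rewrite /= !inE !negb_or (adj_neq xu) xy (adj_neq xv) (adj_neq uy).
  by rewrite [y == v]eq_sym (adj_neq vy) eq_sym uv.
rewrite andbT; apply/subsetP => e; rewrite !inE -!orbA => /or4P[] /eqP -> //.
  by rewrite -/(adj _ _) adjC.
by rewrite -/(adj _ _) adjC.
Qed.

Definition walk5 (t : V * V * V * V * V) :=
  let: (a, b, c, d, e) := t in
  [&& adj a b, adj b c, adj c d, adj d e & adj e a].

Definition verts5 (t : V * V * V * V * V) :=
  let: (a, b, c, d, e) := t in [:: a; b; c; d; e].

(** A tuple is sent to the edge set of its cycle. That edge set determines the vertices, so each
    copy comes from at most [5 ^ 5] tuples, a crude but sufficient count. *)
Lemma card_walk5_le :
  (#|[set t | walk5 t && uniq (verts5 t)]| <= 5 ^ 5 * num_cycle_copies 5 G)%N.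
Proof.
pose cyc (t : V * V * V * V * V) : {set {set V}} := let: (a, b, c, d, e) := t in
  [set [set a; b]; [set b; c]; [set c; d]; [set d; e]; [set e; a]].
set W := [set _ | _].
set copies := [set F : {set {set V}} | (F \subset G) && is_cycle_copy 5 F].
have Wcyc t : t \in W -> cyc t \in copies.
  move: t => [[[[a b] c] d] e]; rewrite !inE => /andP[/and5P[ab bc cd de ea] U].
  rewrite is_cycle_copy5 // andbT; apply/subsetP => F.
  by rewrite !inE -!orbA => /orP[|/or4P[]] /eqP ->.
have covcyc t x : x \in verts5 t -> x \in cover (cyc t).
  move: t => [[[[a b] c] d] e]; rewrite !inE => /orP[|/or4P[]] /eqP ->;
    apply/bigcupP.
  - by exists [set a; b]; rewrite !inE ?eqxx.
  - by exists [set b; c]; rewrite !inE ?eqxx ?orbT.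
  - by exists [set c; d]; rewrite !inE ?eqxx ?orbT.
  - by exists [set d; e]; rewrite !inE ?eqxx ?orbT.
  - by exists [set e; a]; rewrite !inE ?eqxx ?orbT.
have covW t x : x \in cover (cyc t) -> x \in verts5 t.
  move: t => [[[[a b] c] d] e] /bigcupP[F]; rewrite !inE -!orbA.
  by move=> /orP[|/or4P[]] /eqP ->; rewrite !inE => /orP[] ->; rewrite ?orbT.
rewrite -sum1_card (partition_big cyc (mem copies)) //=.
rewrite mulnC -sum_nat_const; apply: leq_sum => F _.
rewrite sum1_card.
(* One tuple [t0] of the fibre supplies a set [U] containing the vertices of all the others. *)
have [t0|none] := pickP [pred t | (t \in W) && (cyc t == F)]; last first.
  by rewrite eq_card0.
move=> /= /andP[_ /eqP t0F].
set U := [set x in verts5 t0].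
have cU : (#|U| <= 5)%N.
  rewrite /U cardsE; apply: leq_trans (card_size _) _.
  by move: {+}t0 => [[[[a b] c] d] e].
apply: (@leq_trans #|setX (setX (setX (setX U U) U) U) U|).
  apply/subset_leq_card/subsetP => t /andP[_ /eqP tF].
  have sub x : x \in verts5 t -> x \in U.
    by move=> /covcyc; rewrite tF -t0F inE => /covW.
  by move: t {tF} sub => [[[[a b] c] d] e] sub; rewrite !in_setX /=
    !sub //= !inE eqxx ?orbT.
rewrite !cardsX; apply: (@leq_trans (#|U| ^ 5)).
  by rewrite !expnSr expn0 mul1n.
by rewrite leq_exp2r.
Qed.

End Cycles.

(** * Closed 5-walks in a subgraph of bounded degree *)

Section Walks.
Variables (R : realFieldType) (V : finType) (G : {set {set V}}) (e : rel V).
Variable (Delta : R).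
Hypothesis simpleG : simple_graph G.
Hypothesis freeG : Ck_free 4 G.
Hypothesis eG : forall x y, e x y -> adj G x y.
Hypothesis esym : forall x y, e x y = e y x.
Let E x y : R := (e x y)%:R.
Hypothesis degE : forall x, \sum_y E x y <= Delta.
Let n : R := #|V|%:R.

Let E0 x y : 0 <= E x y. Proof. exact: ler0n. Qed.
Let Esym x y : E x y = E y x. Proof. by rewrite /E esym. Qed.

Lemma sum_codegree_le1 x y : x != y -> \sum_w E x w * E w y <= 1.
Proof.
move=> xy; apply: (@le_trans _ _ (#|[set w | adj G x w && adj G w y]|%:R)); last first.
  by rewrite lern1 codegree_le1.
rewrite -sum1_card natr_sum [leRHS]big_mkcond /=; apply: ler_sum => w _.
rewrite /E inE -natrM mulnb; case: andP => [[/eG -> /eG ->]|_] //.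
by case: ifP.
Qed.

(** Given an edge [a c], there is at most one common neighbour [d], so only pairs [b], [c] of
    neighbours of [a] remain to be counted. *)
Lemma pendant_triangles_le :
  \sum_a \sum_b \sum_c \sum_d E a b * E a c * (E c d * E d a) <= n * Delta ^+ 2.
Proof.
have D0 (x : V) : 0 <= Delta by apply: le_trans _ (degE x); apply: sumr_ge0.
rewrite mulr_natl -sumr_const; apply: ler_sum => a _.
apply: (@le_trans _ _ (\sum_b \sum_c E a b * E a c)).
  apply: ler_sum => b _; apply: ler_sum => c _; rewrite -mulr_sumr.
  have [ac|nac] := boolP (e a c); last first.
    have -> : E a c = 0 by rewrite /E (negbTE nac).
    by rewrite mulr0 mul0r.
  rewrite ler_piMr ?mulr_ge0 // sum_codegree_le1 //.
  by rewrite eq_sym (adj_neq simpleG (eG ac)).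
rewrite -big_distrlr /= expr2.
by apply: ler_pM; rewrite ?sumr_ge0.
Qed.

Lemma sum_delta (y : V) (F : V -> R) : \sum_x (x == y)%:R * F x = F y.
Proof.
rewrite (bigD1 y) //= eqxx mul1r big1 ?addr0 // => x /negbTE ->.
by rewrite mul0r.
Qed.

(* A closed 5-walk that repeats a vertex is a triangle with a pendant edge. *)
Lemma num_walks5_le :
  num_walks5 E <= 5%:R ^+ 5 * (num_cycle_copies 5 G)%:R + 3 * (n * Delta ^+ 2).
Proof.
pose T x y w z v := (z != x)%:R * (y != z)%:R *
  (E x y * (E y w * E w z) * (E z v * E v x)).
have -> : num_walks5 E = \sum_x \sum_y \sum_w \sum_z \sum_v T x y w z v.
  rewrite /num_walks5 exchange_big; apply: eq_bigr => x _ /=.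
  rewrite exchange_big; apply: eq_bigr => y _ /=.
  rewrite [RHS]exchange_big; apply: eq_bigr => z _ /=; rewrite /codegree.
  transitivity (E x y * (z != x)%:R * (y != z)%:R *
    ((\sum_w E y w * E w z) * (\sum_v E z v * E v x))); first by ring.
  rewrite big_distrlr mulr_sumr; apply: eq_bigr => w _ /=.
  by rewrite mulr_sumr; apply: eq_bigr => v _; rewrite /T; ring.
pose W (t : V * V * V * V * V) := walk5 G t && uniq (verts5 t).
pose K a b c d := E a b * E a c * (E c d * E d a).
have K0 a b c d : 0 <= K a b c d by rewrite /K !mulr_ge0.
(* Edges have distinct ends, and [z != x] and [y != z] are imposed, so the only coincidences left
   are [w = x], [v = w] and [v = y]; each turns the walk into one of the patterns [K]. *)
have TW x y w z v : T x y w z v <= (W (x, y, w, z, v))%:R +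
    (w == x)%:R * K x y z v + (v == w)%:R * K w z x y + (v == y)%:R * K y x w z.
  have rest0 : 0 <= (w == x)%:R * K x y z v + (v == w)%:R * K w z x y +
      (v == y)%:R * K y x w z by rewrite !addr_ge0 // mulr_ge0.
  have [ez|nz] := boolP [&& z != x, y != z, e x y, e y w, e w z, e z v & e v x];
    last first.
    apply: (@le_trans _ _ 0); last by rewrite -!addrA addr_ge0 // !addrA.
    rewrite le_eqVlt; apply/orP; left; move: nz; rewrite /T /E.
    case: (z != x); case: (y != z); case: (e x y); case: (e y w);
      case: (e w z); case: (e z v); case: (e v x) => //= _;
      by rewrite ?(mul0r, mulr0).
  case/and5P: ez => zx yz xy yw /and3P[wz zv vx].
  have nxy := adj_neq simpleG (eG xy); have nyw := adj_neq simpleG (eG yw).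
  have nwz := adj_neq simpleG (eG wz); have nzv := adj_neq simpleG (eG zv).
  have nvx := adj_neq simpleG (eG vx).
  rewrite /T /E zx yz xy yw wz zv vx /= !mul1r.
  have [wx|nwx] := eqVneq w x.
    rewrite -!addrA ler_wpDl // mul1r ler_wpDr ?addr_ge0 ?mulr_ge0 //.
    have xz : e x z by rewrite -wx.
    by rewrite /K /E xy xz zv vx !mul1r.
  have [vw|nvw] := eqVneq v w.
    rewrite -!addrA ler_wpDl // mul0r add0r mul1r ler_wpDr ?mulr_ge0 //.
    have ewx : e w x by rewrite -vw.
    by rewrite /K /E wz ewx xy yw !mul1r.
  have [vy|nvy] := eqVneq v y.
    rewrite !mul0r !addr0 mul1r ler_wpDl //.
    have zy : e z y by rewrite -vy.
    by rewrite /K /E [e y x]esym xy yw wz zy !mul1r.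
  rewrite !mul0r !addr0 ler_nat lt0b /W /= !eG //=.
  rewrite !inE !negb_or nxy [x == w]eq_sym nwx [x == z]eq_sym zx [x == v]eq_sym.
  by rewrite nvx nyw yz [y == v]eq_sym nvy nwz [w == v]eq_sym nvw nzv.
apply: (@le_trans _ _ (\sum_x \sum_y \sum_w \sum_z \sum_v (W (x, y, w, z, v))%:R
  + \sum_x \sum_y \sum_z \sum_v K x y z v
  + \sum_x \sum_y \sum_w \sum_z K w z x y
  + \sum_x \sum_y \sum_w \sum_z K y x w z)).
  rewrite -!big_split /=; apply: ler_sum => x _.
  rewrite -!big_split /=; apply: ler_sum => y _.
  (* The four-fold sums are padded with Kronecker deltas to five-fold ones, so that [TW] applies
     term by term. *)
  have -> : \sum_z \sum_v K x y z v =
      \sum_w \sum_z \sum_v (w == x)%:R * K x y z v.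
    rewrite -[LHS](sum_delta x (fun=> \sum_z \sum_v K x y z v)).
    apply: eq_bigr => w _; rewrite mulr_sumr; apply: eq_bigr => z _.
    by rewrite mulr_sumr.
  rewrite -!big_split /=; apply: ler_sum => w _.
  rewrite -!big_split /=; apply: ler_sum => z _.
  rewrite -[K w z x y](sum_delta w (fun=> K w z x y)).
  rewrite -[K y x w z](sum_delta y (fun=> K y x w z)).
  by rewrite -!big_split /=; apply: ler_sum => v _.
have -> : \sum_x \sum_y \sum_w \sum_z \sum_v (W (x, y, w, z, v))%:R =
    #|[set t | W t]|%:R :> R.
  transitivity (\sum_t (W t)%:R : R); first by rewrite !sum_pair.
  rewrite -sum1_card natr_sum [RHS]big_mkcond; apply: eq_bigr => t _.
  by rewrite inE; case: (W t).
have -> : 3 * (n * Delta ^+ 2) = n * Delta ^+ 2 + n * Delta ^+ 2 + n * Delta ^+ 2.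
  by ring.
rewrite !addrA; apply: lerD; [apply: lerD; [apply: lerD|]|].
- by rewrite -natrX -natrM ler_nat card_walk5_le.
- exact: pendant_triangles_le.
- apply: le_trans pendant_triangles_le.
  under eq_bigr => x _ do rewrite exchange_big.
  rewrite exchange_big /=; apply: ler_sum => w _.
  under eq_bigr => x _ do rewrite exchange_big.
  by rewrite exchange_big.
apply: le_trans pendant_triangles_le.
by rewrite exchange_big.
Qed.

End Walks.

(** * Closed walks through blocks with few bad pairs *)

Section Survivors.
Variables (R : realFieldType) (V : finType).

Variables (w : rel V) (A1 A2 A3 A4 A5 : {set V}).
Let N (A : {set V}) : R := #|A|%:R.
Let dens (A B : {set V}) : R := \sum_(x in A) \sum_(y in B) (w x y)%:R.

(** Union bound: the product of the five good indicators is at least 1 minus the sum of the bad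
    ones. Each bad relation loses at most a tenth of the tuples, so at least half survive. *)
Lemma good_closed_walks_ge :
  10 * dens A1 A2 <= N A1 * N A2 -> 10 * dens A2 A3 <= N A2 * N A3 ->
  10 * dens A3 A4 <= N A3 * N A4 -> 10 * dens A4 A5 <= N A4 * N A5 ->
  10 * dens A5 A1 <= N A5 * N A1 ->
  N A1 * N A2 * N A3 * N A4 * N A5 <=
  2 * \sum_a \sum_b \sum_c \sum_d \sum_e
    (~~ w a b)%:R * (~~ w b c)%:R * (~~ w c d)%:R * (~~ w d e)%:R * (~~ w e a)%:R.
Proof.
move=> h12 h23 h34 h45 h51.
have N0 A : 0 <= N A by apply: ler0n.
pose S := \sum_(a in A1) \sum_(b in A2) \sum_(c in A3) \sum_(d in A4) \sum_(e in A5)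
    (1 - (w a b)%:R - (w b c)%:R - (w c d)%:R - (w d e)%:R - (w e a)%:R : R).
have sumc (A : {set V}) (x : R) : \sum_(a in A) x = N A * x.
  by rewrite sumr_const mulr_natl.
have SE : S = N A1 * N A2 * N A3 * N A4 * N A5
   - dens A1 A2 * (N A3 * N A4 * N A5) - dens A2 A3 * (N A1 * N A4 * N A5)
   - dens A3 A4 * (N A1 * N A2 * N A5) - dens A4 A5 * (N A1 * N A2 * N A3)
   - dens A5 A1 * (N A2 * N A3 * N A4).
  rewrite /S.
  under eq_bigr => a _ do under eq_bigr => b _ do under eq_bigr => c _ do
    under eq_bigr => d _ do rewrite !sumrB !sumc.
  under eq_bigr => a _ do under eq_bigr => b _ do under eq_bigr => c _ do
    rewrite !sumrB -!mulr_sumr !sumc.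
  under eq_bigr => a _ do under eq_bigr => b _ do
    rewrite !sumrB -!mulr_sumr !sumc.
  under eq_bigr => a _ do rewrite !sumrB -!mulr_sumr !sumc.
  rewrite !sumrB -!mulr_sumr !sumc.
  have -> : \sum_(i in A1) \sum_(i0 in A5) (w i0 i)%:R = dens A5 A1.
    by rewrite exchange_big.
  rewrite -/(dens A1 A2) -/(dens A2 A3) -/(dens A3 A4) -/(dens A4 A5); ring.
set W := \sum_a _.
have SW : S <= W.
  have leS (A : {set V}) (F F' : V -> R) :
      (forall x, F x <= F' x) -> (forall x, 0 <= F' x) ->
      \sum_(x in A) F x <= \sum_x F' x.
    move=> le0 F'0; rewrite big_mkcond; apply: ler_sum => x _.
    by case: ifP.
  have pos (a b c d e : V) : 0 <= (~~ w a b)%:R * (~~ w b c)%:R * (~~ w c d)%:R *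
      (~~ w d e)%:R * (~~ w e a)%:R :> R by rewrite !mulr_ge0.
  rewrite /S /W; apply: (leS) => [a|a]; last by do 4![apply: sumr_ge0 => ? _].
  apply: (leS) => [b|b]; last by do 3![apply: sumr_ge0 => ? _].
  apply: (leS) => [c|c]; last by do 2![apply: sumr_ge0 => ? _].
  apply: (leS) => [d|d]; last by do 1![apply: sumr_ge0 => ? _].
  apply: (leS) => [e|e]; last by [].
  by case: (w a b); case: (w b c); case: (w c d); case: (w d e); case: (w e a);
    rewrite /= ?(mul0r, mulr0, mul1r, mulr1); lra.
have scale (x y : R) (z : R) : 10 * x <= y -> 0 <= z -> 10 * (x * z) <= y * z.
  by move=> h z0; rewrite mulrA ler_wpM2r.
have := scale _ _ (N A3 * N A4 * N A5) h12.
have := scale _ _ (N A1 * N A4 * N A5) h23.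
have := scale _ _ (N A1 * N A2 * N A5) h34.
have := scale _ _ (N A1 * N A2 * N A3) h45.
have := scale _ _ (N A2 * N A3 * N A4) h51.
rewrite !mulr_ge0 // => /(_ isT) g1 /(_ isT) g2 /(_ isT) g3 /(_ isT) g4 /(_ isT) g5.
move: SW; rewrite SE; lra.
Qed.

End Survivors.

(** * Edges at vertices of high degree *)

Section HighDegree.
Variables (R : realFieldType) (V : finType) (e : rel V).
Let n : R := #|V|%:R.
Let deg x : R := \sum_y (e x y)%:R.
Hypothesis codeg : forall x y, x != y -> \sum_w (e x w)%:R * (e w y)%:R <= 1 :> R.
Hypothesis esym : forall x y, e x y = e y x.

(** The left side counts paths [y x z]: for [y != z] there is at most one middle vertex, and [y = z]
    contributes a degree. *)
Lemma sum_sqr_deg_le : \sum_x deg x ^+ 2 <= 3 * n ^+ 2.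
Proof.
have deg0 x : 0 <= deg x by apply: sumr_ge0.
have h1 : \sum_x deg x ^+ 2 <= n ^+ 2 + \sum_x deg x.
  have -> : \sum_x deg x ^+ 2 = \sum_y \sum_z \sum_x (e x y)%:R * (e x z)%:R.
    under eq_bigr => x _ do rewrite expr2 big_distrlr /=.
    rewrite exchange_big; apply: eq_bigr => y _ /=.
    by rewrite exchange_big.
  under eq_bigr => y _ do under eq_bigr => z _ do
    under eq_bigr => x _ do rewrite [e x y]esym.
  have -> : n ^+ 2 + \sum_x deg x = \sum_x (n + deg x).
    by rewrite big_split /= sumr_const -[n *+ _]mulr_natr expr2.
  apply: ler_sum => y _.
  rewrite (bigD1 y) //= addrC; apply: lerD.
    apply: (@le_trans _ _ (\sum_(z | z != y) 1)).
      by apply: ler_sum => z zy; apply: codeg; rewrite eq_sym.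
    by rewrite sumr_const ler_nat max_card.
  apply: ler_sum => x _; rewrite [e x y]esym.
  by case: (e y x); rewrite /= ?mul0r ?mul1r.
(* The linear term is absorbed back into the sum of squares. *)
have h2 : 2 * \sum_x deg x <= \sum_x deg x ^+ 2 + n.
  have -> : n = \sum_(x : V) 1 by rewrite sumr_const.
  rewrite mulr_sumr -big_split /=; apply: ler_sum => x _.
  have := sqr_ge0 (deg x - 1); lra.
have h3 : n <= n ^+ 2.
  by rewrite /n -natrX ler_nat; case: #|V| => // m; rewrite -mulnn leq_pmull.
lra.
Qed.

Lemma high_degree_edges_le (K : R) : 0 < K ->
  \sum_(x | K < deg x) deg x <= 3 * n ^+ 2 / K.
Proof.
move=> K0; rewrite ler_pdivlMr // mulr_suml.
apply: le_trans sum_sqr_deg_le; rewrite big_mkcond /=; apply: ler_sum => x _.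
have deg0 : 0 <= deg x by apply: sumr_ge0.
by case: ifP => [h|_]; rewrite ?sqr_ge0 // expr2 ler_wpM2l // ltW.
Qed.

End HighDegree.

(** * The cleaned graph: cost of cleaning and effect of a surviving C5 *)

Section Removal.
Variables (R : realFieldType) (V : finType) (G : {set {set V}}).
Variables (s C kappa eps2 : R).
Hypothesis simpleG : simple_graph G.
Hypothesis freeG : Ck_free 4 G.
Hypothesis s0 : 0 < s.
Hypothesis C0 : 0 < C.
Hypothesis kappa01 : 0 < kappa <= 1.
Hypothesis eps20 : 0 < eps2.
Let n : R := #|V|%:R.
Hypothesis s2 : s ^+ 2 = n.

Let sge0 : 0 <= s. Proof. exact: ltW. Qed.
Let n0 : 0 < n. Proof. by rewrite -s2 exprn_gt0. Qed.

Definition low_degree x := \sum_y (adj G x y)%:R <= C * s.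

Definition low_adj x y := [&& adj G x y, low_degree x & low_degree y].

Definition scaled_adj (p : V * V) : R := s * (low_adj p.1 p.2)%:R.

Let f := scaled_adj.

Lemma low_adj_adj x y : low_adj x y -> adj G x y.
Proof. by case/and3P. Qed.

Lemma low_adjC x y : low_adj x y = low_adj y x.
Proof. by rewrite /low_adj adjC [low_degree x && _]andbC. Qed.

Lemma low_adj_degree_le x : \sum_y (low_adj x y)%:R <= C * s.
Proof.
have [lx|nlx] := boolP (low_degree x); last first.
  rewrite big1 ?mulr_ge0 ?ltW // => y _.
  by rewrite /low_adj (negbTE nlx) andbF.
apply: le_trans lx; apply: ler_sum => y _; rewrite ler_nat.
by rewrite /low_adj; case: (adj G x y) => //=; case: (_ && _).
Qed.

Lemma low_adj_codegree_le1 x y : x != y ->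
  \sum_w (low_adj x w)%:R * (low_adj w y)%:R <= 1 :> R.
Proof. by apply: (sum_codegree_le1 _ simpleG freeG) => *; apply: low_adj_adj. Qed.

Lemma scaled_adj_ge0 p : 0 <= f p.
Proof. by rewrite mulr_ge0 // ltW. Qed.

Lemma low_adj_energy_le k P : bounded_by k P ->
  energy P f <= n ^+ 2 + k%:R * n * (C * s).
Proof.
move=> Pk; apply: (energy_le (E := fun x y => (low_adj x y)%:R) Pk) => //.
- by move=> x y; case: low_adj; rewrite ?expr0n ?expr1n.
- exact: low_adj_degree_le.
move=> x y xy; under eq_bigr => w _ do rewrite [low_adj y w]low_adjC.
exact: low_adj_codegree_le1.
Qed.

Variables (k : nat) (P Q : V -> nat) (eta sigma lambda : R).
Hypothesis Pk : bounded_by k P.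
Hypothesis cutQ : cut_le f Q (eta * n ^+ 2).
Hypothesis closePQ :
  \sum_p (block_avg Q f p - block_avg P f p) ^+ 2 <= sigma * n ^+ 2.
Hypothesis energyP : energy P f <= 2 * n ^+ 2.
Hypothesis lambda0 : 0 < lambda.

Definition sparse x y := block_avg Q f (x, y) < kappa.

Let W (p : V * V) : R := (sparse p.1 p.2)%:R.

(** The part of [x] has fewer than [eps2 * n / k.+1] vertices; the successor keeps this denominator
    positive. *)
Definition tiny x := class_size R P x * k.+1%:R < eps2 * n.

(** The threshold is twice that of [sparse], so a pair that is sparse but not light has block
    averages at least [kappa] apart. *)
Definition light p := block_avg P f p < 2 * kappa.

Definition irregular p := ~~ light p && (1 < 10 * block_avg P W p).

(** Degree and size are tested at the first endpoint only; [cleaned] considers both orientations of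
    an edge. *)
Definition removable (p : V * V) :=
  [|| adj G p.1 p.2 && ~~ low_degree p.1, low_adj p.1 p.2 && tiny p.1,
      low_adj p.1 p.2 && light p |
      low_adj p.1 p.2 && irregular p].

Definition cleaned := [set F in G |
  [forall x, forall y, (F == [set x; y]) ==> ~~ removable (x, y)]].

Lemma card_removed_le : (#|G :\: cleaned| <= #|[set p | removable p]|)%N.
Proof.
apply: leq_trans (leq_imset_card (fun p => [set p.1; p.2]) _).
apply/subset_leq_card/subsetP => F; rewrite !inE negb_and.
case/andP=> /orP[/negP nF /nF //|/forallPn[x /forallPn[y]]].
rewrite negb_imply negbK => /andP[/eqP -> rem] _.
by apply/imsetP; exists (x, y); rewrite ?inE.
Qed.

Let sum_pair_const (c : R) : \sum_(p : V * V) c = c * n ^+ 2.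
Proof. by rewrite sumr_const card_prod -[LHS]mulr_natr natrM -expr2. Qed.

Lemma high_degree_removed :
  \sum_p s * (adj G p.1 p.2 && ~~ low_degree p.1)%:R <= 3 / C * n ^+ 2.
Proof.
rewrite -mulr_sumr sum_pair /=.
have -> : 3 / C * n ^+ 2 = s * (3 * n ^+ 2 / (C * s)).
  by field; rewrite !gt_eqF.
rewrite ler_wpM2l //.
have codeg x y : x != y -> \sum_w (adj G x w)%:R * (adj G w y)%:R <= 1 :> R.
  exact: (sum_codegree_le1 _ simpleG freeG).
apply: le_trans _ (high_degree_edges_le codeg (adjC G) (mulr_gt0 C0 s0)).
rewrite [leRHS]big_mkcond; apply: ler_sum => x _; rewrite ltNge -/(low_degree x).
case: (low_degree x) => /=; first by rewrite big1 // => y _; rewrite andbF.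
by apply: ler_sum => y _; rewrite andbT.
Qed.

(** On a tiny part the inverse class size exceeds [k.+1 / (eps2 * n)], so inserting this ratio only
    increases the sum, and the inverse class sizes add up to at most [k]. *)
Lemma tiny_removed :
  \sum_p s * (low_adj p.1 p.2 && tiny p.1)%:R <= C * eps2 * n ^+ 2.
Proof.
rewrite sum_pair /=.
have row x : \sum_y s * (low_adj x y && tiny x)%:R <=
    s * (C * s) * (eps2 * n / k.+1%:R) / class_size R P x.
  have A0 : 0 < class_size R P x by apply: class_size_gt0.
  have k0 : 0 < k.+1%:R :> R by rewrite ltr0n.
  have [tx|_] := boolP (tiny x); last first.
    rewrite big1 => [|y _]; last by rewrite andbF mulr0.
    by rewrite !mulr_ge0 ?invr_ge0 ?ltW.
  under eq_bigr => y _ do rewrite andbT.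
  rewrite -mulr_sumr -mulrA; apply: le_trans (ler_wpM2l sge0 (low_adj_degree_le x)) _.
  apply: ler_peMr; first by rewrite !mulr_ge0 ?ltW.
  by rewrite ler_pdivlMr // mul1r ler_pdivlMr // ltW.
apply: le_trans (ler_sum _ (fun x _ => row x)) _; rewrite -mulr_sumr.
apply: (@le_trans _ _ (s * (C * s) * (eps2 * n / k.+1%:R) * k.+1%:R)).
  apply: ler_wpM2l; first by rewrite !mulr_ge0 ?invr_ge0 ?ltW.
  by apply: le_trans (sum_inv_class_size R Pk) _; rewrite ler_nat.
rewrite mulrA divfK ?pnatr_eq0 // le_eqVlt; apply/orP; left; apply/eqP.
by rewrite -s2; ring.
Qed.

(** [light] is constant on blocks of [P], so [f] may be replaced by its block average, which is
    below [2 * kappa] there. *)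
Lemma light_removed :
  \sum_p s * (low_adj p.1 p.2 && light p)%:R
    <= 2 * kappa * n ^+ 2.
Proof.
rewrite -sum_pair_const.
rewrite (eq_bigr (fun p => f p * (light p)%:R)); last first.
  by move=> p _; rewrite /f /scaled_adj -mulrA -natrM mulnb.
rewrite -(@sum_avgM _ _ _ (pair_color P)); last first.
  by move=> p q pq; rewrite /light /block_avg (eq_avg _ pq).
apply: ler_sum => p _; rewrite -/(block_avg P f).
rewrite /light; case: ltP => [/ltW h|_]; rewrite ?mulr1 ?mulr0 // ltW //.
by rewrite mulr_gt0 //; case/andP: kappa01.
Qed.

(** Markov inside each block reduces the count to pairs that are sparse but not light; there the
    averages over [P] and [Q] differ by at least [kappa], and [closePQ] limits such pairs as in
    Chebyshev's inequality. *)
Lemma sum_irregular_le :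
  \sum_p (irregular p)%:R <= 10 * sigma / kappa ^+ 2 * n ^+ 2.
Proof.
have /andP[kappa0 _] := kappa01.
apply: (@le_trans _ _
  (10 * \sum_p block_avg P W p * (~~ light p)%:R)).
  rewrite mulr_sumr; apply: ler_sum => p _; rewrite /irregular mulrA.
  have W0 : 0 <= block_avg P W p by apply: avg_ge0 => q; apply: ler0n.
  case: (light p) => /=; rewrite ?mulr1 ?mulr0 //.
  by case: ltP => [/ltW|] //= _; rewrite mulr_ge0.
rewrite sum_avgM; last first.
  by move=> p q pq; rewrite /light /block_avg (eq_avg _ pq).
rewrite -!mulrA ler_wpM2l // [_^-1 * _]mulrC mulrA ler_pdivlMr ?exprn_gt0 //.
apply: le_trans closePQ; rewrite mulr_suml; apply: ler_sum => p _.
rewrite /W; case: p => x y /=; rewrite /sparse.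
case: ltP => [h|_]; last by rewrite !mul0r sqr_ge0.
rewrite /light; case: ltP => [_|h'] /=; first by rewrite mulr0 mul0r sqr_ge0.
have le_diff : kappa <= block_avg P f (x, y) - block_avg Q f (x, y).
  rewrite lerBrDr; apply: le_trans h'.
  by rewrite mulr_natl mulr2n lerD2l ltW.
rewrite !mul1r -[X in _ <= X]sqrrN opprB ler_sqr // nnegrE ltW //.
exact: lt_le_trans le_diff.
Qed.

(** Again [f] is replaced by its block average [a]. Then [a <= lambda * a ^+ 2 + 1 / (4 * lambda)]
    charges one term to the energy and the other to the number of irregular pairs. *)
Lemma irregular_removed :
  \sum_p s * (low_adj p.1 p.2 && irregular p)%:R <=
    (2 * lambda + 10 * sigma / kappa ^+ 2 / (4 * lambda)) * n ^+ 2.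
Proof.
rewrite (eq_bigr (fun p => f p * (irregular p)%:R)); last first.
  by move=> p _; rewrite /f /scaled_adj -mulrA -natrM mulnb.
rewrite -(@sum_avgM _ _ _ (pair_color P)); last first.
  by move=> p q pq; rewrite /irregular /light /block_avg !(eq_avg _ pq).
apply: (@le_trans _ _ (\sum_p (lambda * block_avg P f p ^+ 2 +
    (irregular p)%:R / (4 * lambda)))).
  apply: ler_sum => p _; rewrite -/(block_avg P f p).
  set a := block_avg P f p; case: (irregular p); last first.
    by rewrite mulr0 mul0r addr0 mulr_ge0 ?sqr_ge0 ?ltW.
  rewrite mulr1 mul1r -subr_ge0.
  have -> : lambda * a ^+ 2 + (4 * lambda)^-1 - a =
     lambda * (a - (2 * lambda)^-1) ^+ 2 by field; rewrite gt_eqF.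
  by rewrite mulr_ge0 ?sqr_ge0 ?ltW.
rewrite big_split /= -mulr_sumr -mulr_suml [leRHS]mulrDl.
have inv0 : 0 <= (4 * lambda)^-1 by rewrite invr_ge0 mulr_ge0 // ltW.
apply: lerD; last by rewrite mulrAC; apply: ler_wpM2r inv0 _ _ sum_irregular_le.
by apply: le_trans (ler_wpM2l (ltW lambda0) energyP) _; rewrite mulrCA mulrA.
Qed.

Lemma removed_edges_le :
  s * #|G :\: cleaned|%:R <=
  (3 / C + C * eps2 + 2 * kappa + 2 * lambda
    + 10 * sigma / kappa ^+ 2 / (4 * lambda)) * n ^+ 2.
Proof.
apply: (@le_trans _ _ (\sum_p s * (removable p)%:R)).
  rewrite -mulr_sumr ler_wpM2l //.
  apply: (@le_trans _ _ #|[set p | removable p]|%:R).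
    by rewrite ler_nat card_removed_le.
  rewrite -sum1_card natr_sum big_mkcond; apply: ler_sum => p _.
  by rewrite inE; case: (removable p).
apply: (@le_trans _ _ (\sum_p s * (adj G p.1 p.2 && ~~ low_degree p.1)%:R
  + \sum_p s * (low_adj p.1 p.2 && tiny p.1)%:R
  + \sum_p s * (low_adj p.1 p.2 && light p)%:R
  + \sum_p s * (low_adj p.1 p.2 && irregular p)%:R)).
  rewrite -!big_split /=; apply: ler_sum => p _.
  rewrite -!mulrDr ler_wpM2l // -!natrD ler_nat /removable.
  by do 3![case: (X in (X || _)) => //=].
apply: le_trans (lerD (lerD (lerD high_degree_removed tiny_removed)
  light_removed) irregular_removed) _.
by rewrite -3![in leLHS]mulrDl !addrA.
Qed.

Let heavy (x : V) : eps2 * n / k.+1%:R <= class_size R P x = ~~ tiny x.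
Proof. by rewrite /tiny -leNgt ler_pdivrMr // ltr0n. Qed.

Lemma cleaned_adj x y : adj cleaned x y ->
  [/\ low_adj x y, ~~ tiny x & 10 * block_avg P W (x, y) <= 1].
Proof.
rewrite /adj inE => /andP[xy /forallP all_good].
have good a b : [set x; y] == [set a; b] -> ~~ removable (a, b).
  by move=> e; have /forallP/(_ b)/implyP := all_good a; apply.
have gxy := good x y (eqxx _); have := good y x; rewrite setUC eqxx => /(_ isT).
rewrite /removable /= !negb_or -/(adj G x y) [adj G y x]adjC.
case/and4P=> + _ _ _; rewrite /adj xy negbK => ly.
move: gxy; rewrite /removable /= !negb_or /low_adj /adj xy /= negbK ly andbT.
case/and4P=> lx; rewrite lx /= => tx lxy; rewrite /irregular lxy /= -leNgt.
by split.
Qed.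

Lemma sum_sparse_block x y : 10 * block_avg P W (x, y) <= 1 ->
  10 * (\sum_(a in [set a | P a == P x]) \sum_(b in [set b | P b == P y]) (sparse a b)%:R)
    <= #|[set a | P a == P x]|%:R * #|[set b | P b == P y]|%:R :> R.
Proof.
have cE z : class_size R P z = #|[set a | P a == P z]|%:R.
  by rewrite /class_size -sum1_card natr_sum; apply: eq_bigl => a; rewrite inE.
rewrite -!cE.
have -> : \sum_(a in [set a | P a == P x]) \sum_(b in [set b | P b == P y])
    (sparse a b)%:R = block_avg P W (x, y) * (class_size R P x * class_size R P y).
  rewrite -(class_size_pair R P (x, y)) /block_avg avgM_class_size pair_big /=.
  by apply: eq_bigl => -[a b]; rewrite !inE /pair_color xpair_eqE.
move=> h; rewrite mulrA -[leRHS]mul1r ler_wpM2r // mulr_ge0 // ltW //;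
  exact: class_size_gt0.
Qed.

(** The weight [g] of the counting argument: it lies in [0, 1] and below the average over [Q]. *)
Definition dense_weight x y : R := kappa * (~~ sparse x y)%:R.

(** The parts of [P] containing the five vertices of a surviving cycle serve as [A1] to [A5]: they
    are not tiny, and at most a tenth of the pairs between consecutive ones are sparse. *)
Lemma surviving_cycle : ~ Ck_free 5 cleaned ->
  kappa ^+ 5 * (eps2 * n / k.+1%:R) ^+ 5 <=
  2 * \sum_a \sum_b \sum_c \sum_d \sum_e
    dense_weight a b * dense_weight b c * dense_weight c d * dense_weight d e
      * dense_weight e a.
Proof.
move/eqP; rewrite /num_cycle_copies cards_eq0 => /set0Pn[F]; rewrite inE.
case/andP=> /subsetP FH /existsP[h /andP[_ /eqP FE]].
pose x (i : nat) := h (inord i).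
have xadj (i : 'I_5) : adj cleaned (h i) (h (ordS i)).
  by apply: FH; rewrite FE; apply/imsetP; exists i.
(* Indices are taken modulo 5, so that the closing edge from 4 to 0 is covered. *)
have step (i j : nat) : (i < 5)%N -> j = (i.+1 %% 5)%N -> adj cleaned (x i) (x j).
  move=> i5 ->; have := xadj (Ordinal i5); congr (adj _ (h _) (h _)); apply: val_inj.
    by rewrite /= inordK.
  by rewrite /= inordK // ltn_mod.
have [[_ t0 b0] [_ t1 b1]] := (cleaned_adj (step 0 1 isT erefl),
                                cleaned_adj (step 1 2 isT erefl)).
have [[_ t2 b2] [_ t3 b3]] := (cleaned_adj (step 2 3 isT erefl),
                                cleaned_adj (step 3 4 isT erefl)).
have [_ t4 b4] := cleaned_adj (step 4 0 isT erefl).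
have := good_closed_walks_ge (sum_sparse_block b0) (sum_sparse_block b1)
  (sum_sparse_block b2) (sum_sparse_block b3) (sum_sparse_block b4).
have cE z : #|[set a | P a == P z]|%:R = class_size R P z.
  by rewrite /class_size -sum1_card natr_sum; apply: eq_bigl => a; rewrite inE.
rewrite !cE => le_walks.
have kappa5 : 0 <= kappa ^+ 5 by rewrite exprn_ge0 // ltW //; case/andP: kappa01.
have m0 : 0 <= eps2 * n / k.+1%:R.
  by rewrite !mulr_ge0 ?invr_ge0 ?ltW.
have hm z : ~~ tiny z -> eps2 * n / k.+1%:R <= class_size R P z by rewrite heavy.
move: (eps2 * n / k.+1%:R) m0 hm => m m0 hm.
apply: le_trans (_ : kappa ^+ 5 * (class_size R P (x 0) * class_size R P (x 1)
   * class_size R P (x 2) * class_size R P (x 3) * class_size R P (x 4)) <= _).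
  apply: ler_wpM2l => //; rewrite !exprSr expr0 mul1r.
  by rewrite !ler_pM ?mulr_ge0 ?hm.
apply: le_trans (ler_wpM2l kappa5 le_walks) _.
rewrite mulrCA ler_wpM2l //.
do 5![rewrite mulr_sumr; apply: ler_sum => ? _].
by rewrite /dense_weight le_eqVlt; apply/orP; left; apply/eqP; ring.
Qed.

(** The bound from the surviving cycle is compared with [counting] and [num_walks5_le] and divided
    by [n ^+ 5]. The last term collects the degenerate walks and the diagonal corrections. *)
Lemma surviving_density : ~ Ck_free 5 cleaned ->
  (kappa * eps2 / k.+1%:R) ^+ 5 <=
  2 * 5%:R ^+ 5 * ((num_cycle_copies 5 G)%:R / (n ^+ 2 * s))
  + 2 * (3 + 2 * C) * eta + (6 * C ^+ 2 + 4 * C) / s.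
Proof.
move/surviving_cycle; have /andP[kappa0 kappa1] := kappa01.
have dw01 x y : 0 <= dense_weight x y <= 1.
  by rewrite /dense_weight; case: (sparse x y) => /=;
    rewrite ?mulr0 ?mulr1 ?lexx ?ler01 //= ?(ltW kappa0).
have cutg (S T : {set V}) : \sum_(x in S) \sum_(y in T)
    (dense_weight x y - s * (low_adj x y)%:R) <= eta * n ^+ 2.
  apply: le_trans (cutQ S T); apply: ler_sum => x _; apply: ler_sum => y _.
  rewrite lerD2r /dense_weight /sparse; case: ltP => [_|h]; last by rewrite mulr1.
  by rewrite mulr0; apply: avg_ge0; apply: scaled_adj_ge0.
have E01 x y : 0 <= ((low_adj x y)%:R : R) <= 1.
  by case: low_adj; rewrite ?lexx ler01.
have CS0 : 0 <= C * s by rewrite mulr_ge0 // ltW.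
have := counting E01 low_adj_degree_le low_adj_codegree_le1 dw01 CS0 sge0 s2 cutg.
have := num_walks5_le simpleG freeG low_adj_adj low_adjC low_adj_degree_le.
set X := \sum_a _; set N5 := num_walks5 _; set cp := (num_cycle_copies 5 G)%:R.
rewrite -/n => leN leX leS.
have s5 : 0 <= s ^+ 5 by rewrite exprn_ge0.
have n5 : 0 < n ^+ 5 by rewrite exprn_gt0.
rewrite -(ler_pM2r n5).
have -> : (kappa * eps2 / k.+1%:R) ^+ 5 * n ^+ 5 =
  kappa ^+ 5 * (eps2 * n / k.+1%:R) ^+ 5 by rewrite !exprMn; ring.
apply: le_trans leS _.
apply: le_trans (_ : 2 * (s ^+ 5 * (5%:R ^+ 5 * cp + 3 * (n * (C * s) ^+ 2)) +
  eta * (n ^+ 5 + s * (C * s) * n ^+ 4 + n ^+ 5 + C * s * s * n ^+ 4 + n ^+ 5) +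
  2 * (C * s) * n ^+ 4) <= _).
  apply: ler_wpM2l => //; apply: le_trans leX _.
  by rewrite !lerD2r; apply: ler_wpM2l.
rewrite le_eqVlt; apply/orP; left; apply/eqP; rewrite -s2; field.
by rewrite gt_eqF.
Qed.

End Removal.

(** * Choice of the constants and conclusion *)

Theorem theorem1p1 (R : realType) :
  forall eps : R, 0 < eps ->
  exists delta : R, 0 < delta /\
  exists n0 : nat, forall n : nat, (n0 <= n)%N ->
  forall G : {set {set 'I_n}},
    simple_graph G ->
    Ck_free 4 G ->
    (num_cycle_copies 5 G)%:R <= delta * (n%:R ^+ 2 * Num.sqrt n%:R) ->
    exists H : {set {set 'I_n}},
      H \subset G /\
      (#|G :\: H|)%:R <= eps * (n%:R * Num.sqrt n%:R) /\
      Ck_free 5 H.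
Proof.
move=> eps eps0.
(* These values make each of the five terms in [removed_edges_le] at most [eps / 5]; the minimum
   with 1 keeps the weights in [0, 1]. *)
pose C := 15 / eps; pose kappa := Num.min 1 (eps / 10).
pose eps2 := eps / (5 * C); pose lambda := eps / 10.
pose sigma := eps * lambda * kappa ^+ 2 * 4 / 50.
have C0 : 0 < C by rewrite divr_gt0.
have kappa0 : 0 < kappa by rewrite lt_min ltr01 divr_gt0.
have kappa1 : kappa <= 1 by rewrite ge_min lexx.
have kappa_eps : 2 * kappa <= eps / 5.
  have : kappa <= eps / 10 by rewrite ge_min lexx orbT.
  lra.
have eps20 : 0 < eps2 by rewrite divr_gt0 // mulr_gt0.
have lambda0 : 0 < lambda by rewrite divr_gt0.
have sigma0 : 0 < sigma.
  by rewrite divr_gt0 // mulr_gt0 // (mulr_gt0 (mulr_gt0 _ _)) // exprn_gt0.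
pose gamma (k : nat) := (kappa * eps2 / k.+1%:R) ^+ 5.
have gamma0 k : 0 < gamma k.
  by rewrite exprn_gt0 // divr_gt0 ?ltr0n // mulr_gt0.
have C32 : 0 < 3 + 2 * C by rewrite addr_gt0 // mulr_gt0.
(* The cut error in [surviving_density] becomes [gamma k / 4]. *)
pose eta k := gamma k / (8 * (3 + 2 * C)).
have eta0 k : 0 < eta k by rewrite divr_gt0 // mulr_gt0.
(* Energies will be at most [2 * n ^+ 2], which [m k] increments of [eta k ^+ 2 * n ^+ 2], or [j] of
   [sigma * n ^+ 2], would exceed. *)
pose m k := Num.bound (2 / eta k ^+ 2); pose j := Num.bound (2 / sigma).
pose K := iter j (tower m) 1%N.
(* The final number of parts is only known to be at most [K], so [delta] and the threshold on [n]
   are set by the smallest value [gamma K]. *)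
have gammaK k : (k <= K)%N -> gamma K <= gamma k.
  have g0 i : 0 <= kappa * eps2 / i.+1%:R.
    exact: divr_ge0 (ltW (mulr_gt0 kappa0 eps20)) (ler0n _ _).
  move=> kK; rewrite lerXn2r ?nnegrE ?g0 //.
  by rewrite (ler_pM2l (mulr_gt0 kappa0 eps20)) lef_pV2 ?posrE ?ltr0n // ler_nat.
pose D := 6 * C ^+ 2 + 4 * C.
have D0 : 0 < D by rewrite addr_gt0 // mulr_gt0 // ?exprn_gt0.
(* From [M < s] follow [C * K <= s], for the energy bound, and [4 * D / gamma K < s], for the error
   term [D / s]. *)
pose M := 1 + C * K%:R + 4 * D / gamma K.
have M1 : 1 <= M.
  rewrite /M -addrA lerDl; apply: addr_ge0; first by rewrite mulr_ge0 // ltW.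
  by rewrite divr_ge0 ?(ltW (gamma0 K)) // mulr_ge0 // ltW.
exists (gamma K / (8 * 5%:R ^+ 5)); split.
  by rewrite divr_gt0 // mulr_gt0 // exprn_gt0.
exists (Num.bound (M ^+ 2)) => n len G simpleG freeG few.
set s := Num.sqrt _ in few *.
have n_ge0 : 0 <= n%:R :> R by apply: ler0n.
have s2 : s ^+ 2 = n%:R by rewrite sqr_sqrtr.
have M0 : 0 < M by apply: lt_le_trans M1.
have ltMs : M < s.
  rewrite -ltr_sqr ?nnegrE ?sqrtr_ge0 ?(ltW M0) // s2.
  apply: lt_le_trans (archi_boundP (sqr_ge0 M)) _.
  by rewrite ler_nat.
have s0 : 0 < s by apply: lt_trans ltMs.
have cV : #|'I_n|%:R = n%:R :> R by rewrite card_ord.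
have s2' : s ^+ 2 = #|'I_n|%:R by rewrite cV.
have n0 : 0 < n%:R :> R by rewrite -s2 exprn_gt0.
have n20 : 0 < n%:R ^+ 2 :> R by rewrite exprn_gt0.
pose f := scaled_adj G s C.
have energy_f k Q : (k <= K)%N -> bounded_by k Q ->
    energy Q f <= 2 * #|'I_n|%:R ^+ 2.
  move=> kK Qk; apply: le_trans (low_adj_energy_le simpleG freeG s0 C0 s2' Qk) _.
  rewrite cV [leRHS]mulr_natl mulr2n lerD2l.
  have -> : k%:R * n%:R * (C * s) = k%:R * C * (n%:R * s) by ring.
  have -> : n%:R ^+ 2 = s * (n%:R * s) by rewrite expr2 -{1}s2; ring.
  apply: ler_wpM2r; first by rewrite mulr_ge0 // ltW.
  apply: le_trans _ (ltW ltMs); rewrite /M addrAC [leRHS]addrC mulrC.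
  apply: (@le_trans _ _ (C * K%:R)); first by rewrite ler_pM2l ?ler_nat.
  by rewrite lerDl addr_ge0 // divr_ge0 ?(ltW (gamma0 K)) // mulr_ge0 // ltW.
have mB k : 2 * #|'I_n|%:R ^+ 2 < (m k)%:R * (eta k ^+ 2 * #|'I_n|%:R ^+ 2).
  rewrite cV mulrA ltr_pM2r // -ltr_pdivrMr ?exprn_gt0 //.
  by rewrite archi_boundP // divr_ge0 ?sqr_ge0.
(* The iteration starts from the partition with a single part. *)
have P0 : bounded_by 1 (fun _ : 'I_n => 0%N) by [].
have jB : 2 * #|'I_n|%:R ^+ 2 <
    energy (fun=> 0%N) f + j%:R * (sigma * #|'I_n|%:R ^+ 2).
  rewrite ltr_wpDl ?energy_ge0 // cV mulrA ltr_pM2r // -ltr_pdivrMr //.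
  by rewrite archi_boundP // divr_ge0 // ltW.
have [k [P [Q [kK Pk QP cutQ closePQ]]]] := strong_regularity eta0 mB P0 energy_f jB.
have kappa01 : 0 < kappa <= 1 by rewrite kappa0.
exists (cleaned G s C kappa eps2 k P Q); split.
  by apply/subsetP => F; rewrite inE => /andP[].
split.
  have := removed_edges_le simpleG freeG s0 C0 kappa01 eps20 s2' Pk closePQ
    (energy_f _ _ kK Pk) lambda0.
  rewrite cV => removed.
  rewrite -(ler_pM2l s0); apply: le_trans removed _.
  have -> : s * (eps * (n%:R * s)) = eps * n%:R ^+ 2 by rewrite -s2; ring.
  apply: ler_wpM2r; first exact: ltW.
  have -> : 3 / C = eps / 5 by rewrite /C; field; rewrite gt_eqF.
  have -> : C * eps2 = eps / 5 by rewrite /eps2; field; rewrite gt_eqF.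
  have -> : 10 * sigma / kappa ^+ 2 / (4 * lambda) = eps / 5.
    by rewrite /sigma; field; rewrite !gt_eqF.
  have -> : 2 * lambda = eps / 5 by rewrite /lambda; field.
  move: kappa_eps; lra.
(* If a C5 survived, three error terms of at most [gamma k / 4] each would add up to at least
   [gamma k], which is positive. *)
case: (eqVneq (num_cycle_copies 5 (cleaned G s C kappa eps2 k P Q)) 0%N) => [//|nfree].
have := surviving_density simpleG freeG s0 C0 kappa01 eps20 s2' cutQ (elimN eqP nfree).
rewrite -/(gamma k) -/D cV => le_gamma.
have count_small : 2 * 5%:R ^+ 5 * ((num_cycle_copies 5 G)%:R / (n%:R ^+ 2 * s))
    <= gamma k / 4.
  apply: le_trans (_ : gamma K / 4 <= _); last by rewrite ler_wpM2r ?gammaK ?invr_ge0.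
  have -> : gamma K / 4 = 2 * 5%:R ^+ 5 * (gamma K / (8 * 5%:R ^+ 5)).
    by field.
  apply: ler_wpM2l; first by rewrite mulr_ge0 // exprn_ge0.
  by rewrite ler_pdivrMr // mulr_gt0.
have cut_small : 2 * (3 + 2 * C) * eta k = gamma k / 4.
  by rewrite /eta; field; rewrite gt_eqF.
have n_large : D / s < gamma k / 4.
  apply: lt_le_trans (_ : gamma K / 4 <= _); last by rewrite ler_wpM2r ?gammaK ?invr_ge0.
  rewrite ltr_pdivrMr // mulrC -ltr_pdivrMr ?divr_gt0 //.
  apply: le_lt_trans ltMs; rewrite invf_div mulrA [D * 4]mulrC lerDr.
  by rewrite addr_ge0 // mulr_ge0 // ltW.
have := gamma0 k; move: le_gamma count_small n_large; rewrite cut_small.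
move: (2 * 5%:R ^+ 5 * _) (D / s) (gamma k) => a b c; lra.
Qed.
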